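(* If the theory $\mathbf{V}\cup\mathbf{KK}$ is closed generic, then there is at most one propositional atom.
   Context: Fix a nonempty set of symbols called propositional atoms and a symbol $\mathrm{K}$ which is not a propositional atom. Formulas are defined recursively: every propositional atom is a formula; if $\varphi,\psi$ are formulas then so are $\neg\varphi$, $(\varphi\wedge\psi)$, $(\varphi\vee\psi)$, $(\varphi\rightarrow\psi)$; if $\varphi$ is a formula then so is $\mathrm{K}(\varphi)$. A formula is basic if it is a propositional atom or of the form $\mathrm{K}\varphi$. A theory is a set of formulas. A model is a function assigning a truth value to every basic formula; truth $\mathscr M\models\varphi$ of an arbitrary formula is defined from the values of basic formulas by the classical truth tables (formulas $\mathrm{K}\varphi$ are treated like atoms). $\mathscr M\models T$ means $\mathscr M\models\varphi$ for all $\varphi\in T$; $T\models\varphi$ means every model of $T$ satisfies $\varphi$; $\varphi$ is valid if $\emptyset\models\varphi$. A theory $T$ is closed if $\varphi\in T$ implies $\mathrm{K}\varphi\in T$. $\mathbf{V}=\{\mathrm{K}\varphi:\varphi\text{ valid}\}$; $\mathbf{KK}=\{\mathrm{K}\varphi\rightarrow\mathrm{K}\mathrm{K}\varphi\}$ (all formulas of this form). For a theory $T$ and a set $S$ of propositional atoms, $\mathscr M_{T,S}$ is the model with $\mathscr M_{T,S}\models p$ iff $p\in S$ for atoms $p$, and $\mathscr M_{T,S}\models\mathrm{K}\varphi$ iff $T\models\varphi$. A theory $T$ is closed generic if for every set $S$ of propositional atoms and every closed theory $T'\supseteq T$, $\mathscr M_{T',S}\models T$. *)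

(* Defs.v *)
From mathcomp Require Import all_boot.
From mathcomp Require Import boolp classical_sets.

Set Implicit Arguments.
Unset Strict Implicit.
Unset Printing Implicit Defensive.

Local Open Scope classical_set_scope.

(* [Know f] is K(f); constructor disjointness makes K distinct from all atoms. *)
Inductive formula (A : Type) : Type :=
| Atom of A
| Not of formula A
| And of formula A & formula A
| Or of formula A & formula A
| Imp of formula A & formula A
| Know of formula A.

Definition is_basic (A : Type) (f : formula A) : bool :=
  match f with
  | Atom _ | Know _ => true
  | _ => false
  end.

Definition model (A : Type) : Type := {f : formula A | is_basic f} -> bool.

Definition theory (A : Type) : Type := set (formula A).

Fixpoint holds (A : Type) (M : model A) (f : formula A) : bool :=
  match f with
  | Atom p => M (exist _ (Atom p) isT)
  | Not g => ~~ holds M g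
  | And g h => holds M g && holds M h
  | Or g h => holds M g || holds M h
  | Imp g h => holds M g ==> holds M h
  | Know g => M (exist _ (Know g) isT)
  end.

Definition models (A : Type) (M : model A) (T : theory A) : Prop :=
  forall f, T f -> holds M f.

Definition entails (A : Type) (T : theory A) (f : formula A) : Prop :=
  forall M : model A, models M T -> holds M f.

Definition valid (A : Type) (f : formula A) : Prop := entails set0 f.

Definition closed_theory (A : Type) (T : theory A) : Prop :=
  forall f, T f -> T (Know f).

Definition V (A : Type) : theory A :=
  [set Know f | f in [set f : formula A | valid f]].

Arguments V A : clear implicits.

Definition KK (A : Type) : theory A :=
  [set Imp (Know f) (Know (Know f)) | f in [set: formula A]].

Arguments KK A : clear implicits.

(* The [_ => false] branch is unreachable: the argument is a basic formula. *)
Definition canonical_model (A : Type) (T : theory A) (S : set A) : model A :=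
  fun b => match sval b with
           | Atom p => `[< S p >]
           | Know f => `[< entails T f >]
           | _ => false
           end.

Definition closed_generic (A : Type) (T : theory A) : Prop :=
  forall (S : set A) (T' : theory A),
    closed_theory T' -> T `<=` T' -> models (canonical_model T' S) T.

(* Main.v *)
(* Without the distribution axiom, K need not respect logical equivalence. Let M be a
   model in which the atom p is true and K f holds for every f except ~~p. The
   sentences of M other than ~~p form a closed theory containing V and KK; it contains
   p, so it entails ~~p, but M shows that it does not entail K(~~p). Its canonical
   models thus refute K(~~p) -> KK(~~p). One atom already suffices for this, so the
   hypothesis of the theorem is in fact contradictory. *)
Require Import Defs.
From mathcomp Require Import all_boot.
From mathcomp Require Import boolp classical_sets.

Local Open Scope classical_set_scope.

(** Atoms are true here too, as none has the form [Know g]. *)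
Definition ignorant_model {A : Type} (g : formula A) : model A :=
  fun b => `[< sval b <> Know g >].

Lemma V_KK_not_closed_generic (A : Type) (p : A) :
  ~ closed_generic (V A `|` KK A).
Proof.
set g := Not (Not (Atom p)); set M := ignorant_model g.
pose T' : theory A := [set f | holds M f /\ f <> g].
have KM f : f <> g -> holds M (Know f) by move=> fg; apply/asboolP => -[].
(* The model that makes every basic formula false refutes [g]. *)
have g_notvalid : ~ valid g by move=> g_valid; have := g_valid (fun=> false) (fun f => False_ind _).
(* [g] is a negation, so no [Know f] is lost by excluding [g]. *)
have T'_closed : closed_theory T' by move=> f [_ /KM].
have sub_T' : V A `|` KK A `<=` T'.
  move=> _ [[f f_valid <-]|[f _ <-]]; split=> //.
    by apply: KM => fg; apply: g_notvalid; rewrite -fg.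
  (* The consequent holds in [M] because [Know f] is not [g]. *)
  by apply/implyP => _; apply: KM.
have T'_g : entails T' g.
  move=> N /(_ (Atom p)) Np; rewrite /= negbK; apply: Np.
  by split=> //; apply/asboolP.
have T'_nKg : ~ entails T' (Know g).
  move=> /(_ M) MKg; suff /asboolP : holds M (Know g) by [].
  by apply: MKg => f [].
move=> generic; have KKg : (V A `|` KK A) (Imp (Know g) (Know (Know g))).
  by right; exists g.
(* The choice of [set0] is arbitrary: the set fixes only atoms, and this instance of [KK] is built
   from K-formulas. *)
have /implyP KgKKg := generic set0 T' T'_closed sub_T' _ KKg.
by apply: T'_nKg; apply/asboolP/KgKKg/asboolP.
Qed.

Theorem theorem24 (A : Type) (A_nonempty : inhabited A) :
  closed_generic (V A `|` KK A) -> forall p q : A, p = q.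
Proof. by move=> generic p; case: (@V_KK_not_closed_generic A p generic). Qed.
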